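(* Let $n\ge 3$, let $G_1,G_2$ be disjoint copies of the cycle $C_n$, and let $f:V(G_1)\to V(G_2)$ be a function. Then $\gamma(C_n)=\gamma(C(C_n,f))$ if and only if there is a minimum dominating set $D$ of $C(C_n,f)$, with $D_1=D\cap V(G_1)$ and $D_2=D\cap V(G_2)$, such that either: (1) $D_1=\emptyset$, $D_2$ is a minimum dominating set of $G_2$, and $\mathrm{Range}(f)\subseteq D_2$; or (2) $n\equiv 1\pmod 3$, there is a vertex $v\in V(G_2)$ such that $D_2$ is a minimum dominating set of the induced subgraph $\langle V(G_2)\setminus\{v\}\rangle$, $D_1=\{w\}$ with $f(w)=v$, and $f(V(G_1)\setminus N[w])\subseteq D_2$.
   Context: For disjoint copies $G_1,G_2$ of a graph $G$ and a function $f:V(G_1)\to V(G_2)$, the functigraph $C(G,f)$ has vertex set $V(G_1)\cup V(G_2)$ and edge set $E(G_1)\cup E(G_2)\cup\{uv : u\in V(G_1), v\in V(G_2), v=f(u)\}$. $\gamma(H)$ is the domination number of $H$; $N[w]$ is the closed neighborhood of $w$ in $C(C_n,f)$; $\langle S\rangle$ denotes the induced subgraph on $S$. *)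

(* Defs.v *)
From mathcomp Require Import all_boot.

Set Implicit Arguments.
Unset Strict Implicit.
Unset Printing Implicit Defensive.

Record sgraph := SGraph {
  vertex :> finType;
  adj : rel vertex;
  adj_sym : symmetric adj;
  adj_irr : irreflexive adj }.

Definition closed_nbhd (G : sgraph) (w : G) : {set G} :=
  [set x | (x == w) || adj w x].

Definition dominating (G : sgraph) (D : {set G}) : bool :=
  [forall x, (x \in D) || [exists y in D, adj y x]].

(* The default [set: G] is itself dominating (dominating_setT), so the arg min
   is a genuine minimiser. *)
Definition domination_number (G : sgraph) : nat :=
  #|[arg min_(D < [set: G] | dominating D) #|D|]|.

Definition min_dominating (G : sgraph) (D : {set G}) : bool :=
  dominating D && (#|D| == domination_number G).

Lemma dominating_setT (G : sgraph) : dominating [set: G].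
Proof. by apply/forallP => x; rewrite inE. Qed.

Lemma domination_number_le (G : sgraph) (D : {set G}) :
  dominating D -> domination_number G <= #|D|.
Proof.
rewrite /domination_number; case: arg_minnP; first exact: dominating_setT.
by move=> D0 _; apply.
Qed.

Section Induced.
Variables (G : sgraph) (S : {set G}).

Definition induced_adj : rel {x : G | x \in S} :=
  fun x y => adj (val x) (val y).

Lemma induced_adj_sym : symmetric induced_adj.
Proof. by move=> x y; apply: adj_sym. Qed.

Lemma induced_adj_irr : irreflexive induced_adj.
Proof. by move=> x; apply: adj_irr. Qed.

Definition induced : sgraph := SGraph induced_adj_sym induced_adj_irr.

Definition induced_val : induced -> G := val.

End Induced.

(* The conjunct i != j only matters for n = 1, where it removes a loop; the
   result is the cycle graph for n >= 3. *)
Definition cycle_adj (n : nat) : rel 'I_n :=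
  fun i j => (i != j) && ((j == i.+1 %% n :> nat) || (i == j.+1 %% n :> nat)).

Lemma cycle_adj_sym n : symmetric (@cycle_adj n).
Proof. by move=> i j; rewrite /cycle_adj eq_sym orbC. Qed.

Lemma cycle_adj_irr n : irreflexive (@cycle_adj n).
Proof. by move=> i; rewrite /cycle_adj eqxx. Qed.

Definition cycle_graph (n : nat) : sgraph :=
  SGraph (@cycle_adj_sym n) (@cycle_adj_irr n).

Section Functigraph.
Variables (G : sgraph) (f : G -> G).

(* The disjoint copies G_1 and G_2 of G are the two summands of G + G; f, a map
   from V(G_1) to V(G_2), is given as a map between the underlying vertices. *)
Definition functigraph_adj : rel (G + G)%type :=
  fun a b => match a, b with
  | inl u, inl v | inr u, inr v => adj u v
  | inl u, inr v | inr v, inl u => v == f u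
  end.

Lemma functigraph_adj_sym : symmetric functigraph_adj.
Proof. by case=> u [] v //=; apply: adj_sym. Qed.

Lemma functigraph_adj_irr : irreflexive functigraph_adj.
Proof. by case=> u /=; apply: adj_irr. Qed.

Definition functigraph : sgraph :=
  SGraph functigraph_adj_sym functigraph_adj_irr.

Definition copy1 : G -> functigraph := inl.
Definition copy2 : G -> functigraph := inr.

End Functigraph.

(* Main.v *)
(* A vertex of [C_n] dominates at most three vertices, so [gamma(C_n)] is [n / 3]
   rounded up.  Let [D] be a minimum dominating set of [C(C_n, f)] with
   [a = #|D_1|], [b = #|D_2|] and [a + b = gamma(C_n)].  Each vertex of [D_1]
   dominates a single vertex of [G_2], so [n <= 3 b + a], and hence
   [2 a <= 3 gamma(C_n) - n <= 2].  If [a = 0] this is case (1).  If [a = 1] then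
   [n = 3 b + 1], so the closed neighbourhoods of [D_2] must cover exactly the
   vertices of [G_2] other than [v = f w]; this is case (2). *)
Require Import Defs.
From mathcomp Require Import all_boot zify.

Set Implicit Arguments.
Unset Strict Implicit.
Unset Printing Implicit Defensive.

(** * Closed neighbourhoods of sets, in a graph and in its induced subgraphs *)

Lemma min_dominating_exists (G : sgraph) : exists D : {set G}, min_dominating D.
Proof.
rewrite /min_dominating /domination_number.
case: arg_minnP => [|D domD _]; first exact: dominating_setT.
by exists D; rewrite domD eqxx.
Qed.

Definition nbhd_set (G : sgraph) (D : {set G}) : {set G} :=
  \bigcup_(y in D) closed_nbhd y.

Lemma nbhd_setP (G : sgraph) (D : {set G}) (x : G) :
  (x \in nbhd_set D) = (x \in D) || [exists y in D, adj y x].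
Proof.
apply/bigcupP/orP => [[y yD]|[xD|/exists_inP[y yD yx]]].
- rewrite inE => /orP[/eqP->|yx]; [by left|right].
  by apply/exists_inP; exists y.
- by exists x; rewrite // inE eqxx.
- by exists y; rewrite // inE yx orbT.
Qed.

Lemma dominatingP (G : sgraph) (D : {set G}) :
  reflect (forall x, x \in nbhd_set D) (dominating D).
Proof.
by apply: (iffP forallP) => domD x; have := domD x; rewrite nbhd_setP.
Qed.

Section InducedDomination.
Variables (G : sgraph) (S : {set G}).

Lemma induced_val_inj : injective (@induced_val G S).
Proof. exact: val_inj. Qed.

(** Adjacency is inherited from [G], so domination in the subgraph becomes a covering condition in
    [G], where closed neighbourhoods can be counted. *)
Lemma dominating_induced (X : {set induced S}) :
  dominating X <-> S \subset nbhd_set (@induced_val G S @: X).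
Proof.
split=> [/dominatingP domX|/subsetP covS].
  apply/subsetP => x xS; have /bigcupP[y yX xy] := domX (exist _ x xS).
  apply/bigcupP; exists (induced_val y); first exact: imset_f.
  by move: xy; rewrite !inE -val_eqE.
apply/dominatingP => x; have /bigcupP[_ /imsetP[y yX ->] yx] := covS _ (valP x).
apply/bigcupP; exists y => //.
by move: yx; rewrite !inE -val_eqE.
Qed.

Lemma induced_val_preimset (D : {set G}) :
  D \subset S -> @induced_val G S @: (@induced_val G S @^-1: D) = D.
Proof.
move=> /subsetP DS; apply/setP => x; apply/imsetP/idP => [[y]|xD].
  by rewrite inE => yD ->.
by exists (exist _ x (DS _ xD)); rewrite // inE.
Qed.

Lemma induced_domination_number_le (D : {set G}) :
  D \subset S -> S \subset nbhd_set D -> domination_number (induced S) <= #|D|.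
Proof.
move=> /induced_val_preimset DE covS.
rewrite -DE card_imset; last exact: induced_val_inj.
by apply/domination_number_le/dominating_induced; rewrite DE.
Qed.

End InducedDomination.

(** * Domination in a cycle and in a cycle minus one vertex *)

Section Cycle.
Variable n : nat.
Hypothesis n_ge3 : 3 <= n.

(** Splitting off the edge between [n.-1] and [0] removes the modulus, which brings adjacency within
    reach of [lia]. *)
Lemma cycle_adjE (i j : 'I_n) :
  cycle_adj i j =
  [|| j == i.+1 :> nat, i == j.+1 :> nat,
      (i == n.-1 :> nat) && (j == 0 :> nat)
    | (j == n.-1 :> nat) && (i == 0 :> nat)].
Proof.
have succ_mod (k : 'I_n) : k.+1 %% n = if k == n.-1 :> nat then 0 else k.+1.
  have ltkn := ltn_ord k; case: eqP => [->|kn]; first by rewrite prednK ?modnn; lia.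
  by rewrite modn_small; lia.
rewrite /cycle_adj !succ_mod -val_eqE /=.
have := ltn_ord i; have := ltn_ord j.
by case: ifP => /eqP ?; case: ifP => /eqP ?; lia.
Qed.

Lemma card_closed_nbhd_cycle (w : cycle_graph n) : #|closed_nbhd w| <= 3.
Proof.
have n_gt0 : 0 < n by lia.
pose succ : 'I_n := Ordinal (ltn_pmod w.+1 n_gt0).
(* Adding [n.-1] modulo [n] steps back by one, also from [0], where natural subtraction would
   truncate. *)
pose pred : 'I_n := Ordinal (ltn_pmod (w + n.-1) n_gt0).
apply: (@leq_trans #|[set w; succ; pred]|); last first.
  by apply: leq_trans (leq_card_setU _ _) _; rewrite cards2 cards1; lia.
apply: subset_leq_card; apply/subsetP => x; rewrite !inE => /orP[->//|].
rewrite /adj /= /cycle_adj => /andP[_ /orP[xE|/eqP wE]].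
  by rewrite -[x == succ]val_eqE /= xE orbT.
suff -> : x == pred by rewrite orbT.
rewrite -val_eqE /= wE modnDml.
have -> : x.+1 + n.-1 = x + n by lia.
by rewrite modnDr modn_small.
Qed.

Lemma card_nbhd_set_cycle (D : {set cycle_graph n}) : #|nbhd_set D| <= 3 * #|D|.
Proof.
rewrite /nbhd_set mulnC -sum_nat_const.
elim/big_ind2: _ => [|A k B l leAk leBl|w _]; first by rewrite cards0.
- exact: leq_trans (leq_card_setU _ _) (leq_add leAk leBl).
- exact: card_closed_nbhd_cycle.
Qed.

Lemma domination_number_cycle_ge : n <= 3 * domination_number (cycle_graph n).
Proof.
have [D /andP[/dominatingP domD /eqP <-]] := min_dominating_exists (cycle_graph n).
apply: leq_trans (card_nbhd_set_cycle D).
by rewrite -{1}(card_ord n) -cardsT; apply/subset_leq_card/subsetP => x _.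
Qed.

(** Cut the cycle into [n.+2 %/ 3] consecutive blocks of three, the last possibly shorter, and take
    the vertex [3 * j + 1] in the middle of block [j]. *)
Lemma domination_number_cycle_le : 3 * domination_number (cycle_graph n) <= n.+2.
Proof.
(* The cap acts on a block only when [n] is 1 modulo 3: the last block is then the single vertex
   [n.-1]. *)
have center_lt j : minn (3 * j + 1) n.-1 < n by lia.
pose center j : cycle_graph n := Ordinal (center_lt j).
pose D := [set center (val j) | j : 'I_(n.+2 %/ 3)].
have cardD : #|D| <= n.+2 %/ 3.
  by apply: leq_trans (leq_imset_card _ _) _; rewrite card_ord.
suff /domination_number_le : dominating D by lia.
apply/dominatingP => x; have ltxn : (x : nat) < n := ltn_ord x.
have x3_lt : x %/ 3 < n.+2 %/ 3 by lia.
apply/bigcupP; exists (center (x %/ 3)).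
  by apply/imsetP; exists (Ordinal x3_lt).
by rewrite inE /adj /= cycle_adjE -val_eqE /=; lia.
Qed.

(** Without [v] the cycle is a path on [n.-1] vertices, a multiple of 3, so it splits exactly into
    triples, each dominated by its middle vertex. *)
Lemma domination_number_cycleD1_le (v : cycle_graph n) :
  n = 1 %[mod 3] -> 3 * domination_number (induced (~: [set v])) <= n.-1.
Proof.
move=> n_mod3; have ltvn : (v : nat) < n := ltn_ord v.
(* For [d < n] this is [v + d] modulo [n]. Triple [j] has offsets [3 * j + 1] to [3 * j + 3] from
   [v], hence the centre at [3 * j + 2]. *)
pose shift d := if v + d < n then v + d else v + d - n.
have center_lt (j : 'I_(n %/ 3)) : shift (3 * j + 2) < n.
  by have := ltn_ord j; rewrite /shift; case: ifP; lia.
pose center j : cycle_graph n := Ordinal (center_lt j).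
pose D := [set center j | j : 'I_(n %/ 3)].
have cardD : #|D| <= n %/ 3.
  by apply: leq_trans (leq_imset_card _ _) _; rewrite card_ord.
suff : domination_number (induced (~: [set v])) <= #|D| by lia.
apply: induced_domination_number_le; apply/subsetP => x.
  case/imsetP=> j _ ->; have := ltn_ord j.
  by rewrite !inE -val_eqE /= /shift; case: ifP; lia.
have ltxn : (x : nat) < n := ltn_ord x.
rewrite !inE -val_eqE /= => xv.
(* [d.+1] is the distance from [v] to [x] going upwards around the cycle. *)
pose d := if v < x then x - v.+1 else x + n - v.+1.
have d3_lt : d %/ 3 < n %/ 3 by rewrite /d; case: ifP; lia.
apply/bigcupP; exists (center (Ordinal d3_lt)); first exact: imset_f.
rewrite inE /adj /= cycle_adjE -val_eqE /= /shift.
by rewrite /d; case: ifP; case: ifP; lia.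
Qed.

(** The count is tight: the closed neighbourhood of [D] has at most [3 * #|D| = n.-1] vertices, so
    it is exactly the complement of [v]. Hence [D] avoids [v] and pulls back to the induced
    subgraph. *)
Lemma min_dominating_cycleD1 (v : cycle_graph n) (D : {set cycle_graph n}) :
  ~: [set v] \subset nbhd_set D -> n = 3 * #|D| + 1 ->
  exists X : {set induced (~: [set v])},
    min_dominating X /\ D = @induced_val _ (~: [set v]) @: X.
Proof.
move=> covD nE; have card_v : #|~: [set v]| = n.-1.
  by rewrite cardsC1 card_ord.
have nbhdE : ~: [set v] = nbhd_set D.
  apply/eqP; rewrite eqEcard covD card_v.
  by apply: leq_trans (card_nbhd_set_cycle D) _; lia.
have DS : D \subset ~: [set v].
  by rewrite nbhdE; apply/subsetP => x xD; rewrite nbhd_setP xD.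
have DE := induced_val_preimset DS.
exists (@induced_val _ (~: [set v]) @^-1: D); split=> //.
have domX : dominating (@induced_val _ (~: [set v]) @^-1: D).
  by apply/dominating_induced; rewrite DE.
have cardX : #|@induced_val _ (~: [set v]) @^-1: D| = #|D|.
  by rewrite -[in RHS]DE card_imset //; exact: induced_val_inj.
rewrite /min_dominating domX cardX eqn_leq -{1}cardX.
have n_mod3 : n = 1 %[mod 3] by lia.
have := domination_number_cycleD1_le v n_mod3.
have := domination_number_le domX; rewrite cardX.
(* Minimality: any dominating set [Y] of the subgraph covers [n.-1] vertices of the cycle, so
   [n.-1 <= 3 * #|Y|]. *)
have [Y /andP[/dominating_induced/subset_leq_card + /eqP <-]] :=
  min_dominating_exists (induced (~: [set v])).
have := card_nbhd_set_cycle (@induced_val _ (~: [set v]) @: Y).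
by rewrite card_v card_imset; [lia | exact: induced_val_inj].
Qed.

(** For [n = 3 * k + 1] the two sides are [k.+1]: the path needs [k] vertices and the cycle one
    more. *)
Lemma min_dominating_cycleD1_card (v : cycle_graph n)
    (X : {set induced (~: [set v])}) :
  n = 1 %[mod 3] -> min_dominating X ->
  #|X|.+1 = domination_number (cycle_graph n).
Proof.
move=> n_mod3 /andP[/dominating_induced/subset_leq_card + /eqP cardX].
have := card_nbhd_set_cycle (@induced_val _ (~: [set v]) @: X).
rewrite cardsC1 card_ord card_imset; last exact: induced_val_inj.
have := domination_number_cycleD1_le v n_mod3; rewrite -cardX.
have := domination_number_cycle_ge; have := domination_number_cycle_le.
lia.
Qed.

End Cycle.

(** * Domination in a functigraph, copy by copy *)

Section FunctigraphDomination.
Variables (G : sgraph) (f : G -> G) (D : {set functigraph f}).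
Let D1 := copy1 f @^-1: D.
Let D2 := copy2 f @^-1: D.

Lemma card_copies : #|D| = #|D1| + #|D2|.
Proof.
have -> : D = (copy1 f @: D1) :|: (copy2 f @: D2).
  apply/setP => -[] x; rewrite !inE; apply/idP/orP => [xD|].
  - by left; apply/imsetP; exists x; rewrite ?inE.
  - by case=> /imsetP[y]; rewrite ?inE // => yD ->.
  - by right; apply/imsetP; exists x; rewrite ?inE.
  - by case=> /imsetP[y]; rewrite ?inE // => yD ->.
rewrite cardsU (_ : _ :&: _ = set0) ?cards0 ?subn0; last first.
  apply/setP => x; rewrite !inE; apply/negP => /andP[/imsetP[y _ ->]].
  by case/imsetP.
by rewrite !card_imset // => x y [].
Qed.

Lemma nbhd_set_copy1 (x : G) :
  (copy1 f x \in nbhd_set D) = (x \in nbhd_set D1) || (f x \in D2).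
Proof.
apply/bigcupP/orP => [[[] y yD]|[/bigcupP[y]|]].
- by rewrite inE => yx; left; apply/bigcupP; exists y; rewrite ?inE.
- by rewrite !inE /= => /eqP <-; right.
- by rewrite !inE => yD yx; exists (copy1 f y); rewrite ?inE.
- by rewrite inE => fxD; exists (copy2 f (f x)); rewrite // inE /adj /= eqxx.
Qed.

Lemma nbhd_set_copy2 (x : G) :
  (copy2 f x \in nbhd_set D) = (x \in nbhd_set D2) || (x \in f @: D1).
Proof.
apply/bigcupP/orP => [[[] y yD]|[/bigcupP[y]|/imsetP[y]]].
- rewrite !inE /= => /eqP ->; right.
  by apply/imsetP; exists y; rewrite ?inE.
- by rewrite inE => yx; left; apply/bigcupP; exists y; rewrite ?inE.
- by rewrite !inE => yD yx; exists (copy2 f y); rewrite ?inE.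
- by rewrite inE => yD ->; exists (copy1 f y); rewrite // inE /adj /= eqxx.
Qed.

End FunctigraphDomination.

Theorem theorem3p2 (n : nat) (hn : 3 <= n)
    (f : cycle_graph n -> cycle_graph n) :
  domination_number (cycle_graph n) = domination_number (functigraph f) <->
  exists D : {set functigraph f},
    let D1 := copy1 f @^-1: D in
    let D2 := copy2 f @^-1: D in
    min_dominating D /\
    ([/\ D1 = set0, min_dominating D2 & f @: [set: cycle_graph n] \subset D2]
     \/
     n = 1 %[mod 3] /\
     exists v : cycle_graph n,
       (exists X : {set induced (~: [set v])},
          min_dominating X /\ D2 = @induced_val _ (~: [set v]) @: X) /\
       exists w : cycle_graph n,
         [/\ D1 = [set w], f w = v &
             f @: (~: (copy1 f @^-1: closed_nbhd (copy1 f w))) \subset D2]).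
Proof.
split=> [gammaE|[D /= [/andP[_ /eqP <-]]]]; last first.
  (* Conversely, the sizes of the two parts of [D] add up to the domination number of the cycle, as
     0 plus all of it in case (1), and as 1 plus one less in case (2). *)
  rewrite card_copies => -[[-> /andP[_ /eqP ->] _]|]; first by rewrite cards0.
  case=> n_mod3 [v [[X [minX ->]] [w [-> _ _]]]].
  rewrite cards1 card_imset; last exact: induced_val_inj.
  by rewrite add1n (min_dominating_cycleD1_card hn n_mod3 minX).
have [D minD] := min_dominating_exists (functigraph f); exists D.
split=> //; move: minD => /andP[/dominatingP domD /eqP].
rewrite -gammaE card_copies.
set D1 := copy1 f @^-1: D; set D2 := copy2 f @^-1: D => cardD.
have cov2 : [set: cycle_graph n] \subset nbhd_set D2 :|: f @: D1.
  by apply/subsetP => x _; rewrite inE -nbhd_set_copy2.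
have card_cov2 : n <= 3 * #|D2| + #|D1|.
  rewrite -{1}(card_ord n) -cardsT; apply: leq_trans (subset_leq_card cov2) _.
  apply: leq_trans (leq_card_setU _ _) _.
  by apply: leq_add; [exact: card_nbhd_set_cycle | exact: leq_imset_card].
have gamma_le := domination_number_cycle_le hn.
have [D1_0|D1_1] : #|D1| = 0 \/ #|D1| = 1 by lia.
  left; have D1E : D1 = set0 by apply: cards0_eq.
  split=> //.
    rewrite /min_dominating -cardD D1_0 eqxx andbT; apply/dominatingP => x.
    by have := subsetP cov2 x (in_setT x); rewrite D1E imset0 setU0.
  apply/subsetP => _ /imsetP[x _ ->]; have := domD (copy1 f x).
  by rewrite nbhd_set_copy1 -/D1 D1E /nbhd_set big_set0 inE.
(* [card_cov2] gives one inequality; [gamma_le], with the domination number equal to [#|D2| + 1],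
   gives the other. *)
have nE : n = 3 * #|D2| + 1 by lia.
right; split; first by lia.
have /cards1P[w D1E] : #|D1| == 1 by rewrite D1_1.
exists (f w); split.
  apply: min_dominating_cycleD1 => //; apply/subsetP => x; rewrite !inE => xv.
  by have := subsetP cov2 x (in_setT x); rewrite D1E imset_set1 !inE (negbTE xv) orbF.
exists w; split=> //; apply/subsetP => _ /imsetP[x + ->].
(* As [w] is the only vertex of [D] in the first copy, a vertex [x] of that copy outside its closed
   neighbourhood can only be dominated by [f x]. *)
rewrite 2!inE => xw; have := domD (copy1 f x).
rewrite nbhd_set_copy1 -/D1 D1E /nbhd_set big_set1.
by case/orP => // xw'; case/negP: xw; move: xw'; rewrite !inE.
Qed.
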